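(* Let $\sigma>0$ and let $X$ be a sub-Gaussian random variable with parameter $\sigma$, with CDF $F$. For $n\ge 1$ let $F_n$ be the empirical distribution function of $n$ i.i.d. samples from $F$. Then, for every $n\ge 1$ and every $\epsilon$ such that $\frac{512\sigma}{\sqrt n}<\epsilon<\frac{512\sigma}{\sqrt n}+16\sigma\sqrt{e}$, $$\mathbb{P}\left(W_1(F_n,F)>\epsilon\right)\le \exp\left(-\frac{n}{256\,\sigma^2 e}\left(\epsilon-\frac{512\sigma}{\sqrt n}\right)^2\right),$$ where $e$ is Euler's number.
   Context: A random variable $X$ is sub-Gaussian with parameter $\sigma>0$ if $\mathbb{P}(X\ge\epsilon)\le\exp(-\epsilon^2/(2\sigma^2))$ and $\mathbb{P}(X\le-\epsilon)\le\exp(-\epsilon^2/(2\sigma^2))$ for every $\epsilon>0$ (mean zero is not required). Given i.i.d. samples $X_1,\dots,X_n$ from $F$, the empirical distribution function is $F_n(x)=\frac1n\sum_{i=1}^n \mathbf 1\{X_i\le x\}$. $W_1(F_1,F_2)$ is the 1-Wasserstein distance between CDFs on $\mathbb{R}$: $W_1(F_1,F_2)=\inf\int_{\mathbb{R}^2}|x-y|\,dF(x,y)$, the infimum being over joint distributions $F$ with marginals $F_1,F_2$; equivalently $W_1(F_1,F_2)=\int_{-\infty}^\infty|F_1(s)-F_2(s)|\,ds$. *)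

(* Defs.v *)
From HB Require Import structures.
From mathcomp Require Import all_boot all_order all_algebra.
From mathcomp Require Import all_classical all_reals all_analysis.

Set Implicit Arguments.
Unset Strict Implicit.
Unset Printing Implicit Defensive.

Import Order.TTheory GRing.Theory Num.Theory.
Import numFieldNormedType.Exports.

Local Open Scope classical_set_scope.
Local Open Scope ring_scope.

(* The mean of X is not required to be zero. *)
Definition sub_gaussian (R : realType) (d : measure_display)
    (T : measurableType d) (P : probability T R) (X : {RV P >-> R})
    (sigma : R) : Prop :=
  forall eps : R, 0 < eps ->
    (P [set w | (eps <= X w)%R]
       <= (expR (- (eps ^+ 2 / (2 * sigma ^+ 2))))%:E)%E /\
    (P [set w | (X w <= - eps)%R]
       <= (expR (- (eps ^+ 2 / (2 * sigma ^+ 2))))%:E)%E.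

(* The product rule for a proper subfamily is the case B i = setT for the
   indices i left out. *)
Definition mutually_independent (R : realType) (d : measure_display)
    (T : measurableType d) (P : probability T R) (n : nat)
    (X : 'I_n -> {RV P >-> R}) : Prop :=
  forall B : 'I_n -> set R, (forall i, measurable (B i)) ->
    P [set w | forall i, B i (X i w)] = (\prod_(i < n) P (X i @^-1` B i))%E.

Definition iid_samples (R : realType) (d : measure_display)
    (T : measurableType d) (P : probability T R) (n : nat)
    (X : 'I_n -> {RV P >-> R}) (F : R -> \bar R) : Prop :=
  mutually_independent X /\ forall i, cdf (X i) = F.

(* Distribution functions take values in \bar R, as the library's cdf does. *)
Definition empirical_cdf (R : realType) (n : nat) (x : 'I_n -> R) (t : R)
    : \bar R :=
  (n%:R^-1 * \sum_(i < n) (x i <= t)%R%:R)%:E.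

Definition coupling (R : realType) (F1 F2 : R -> \bar R)
    (gamma : probability (measurableTypeR R * measurableTypeR R)%type R)
    : Prop :=
  (forall t : R, gamma [set z : R * R | (z.1 <= t)%R] = F1 t) /\
  (forall t : R, gamma [set z : R * R | (z.2 <= t)%R] = F2 t).

Definition wasserstein1 (R : realType) (F1 F2 : R -> \bar R) : \bar R :=
  ereal_inf [set (\int[gamma]_z (`|(z.1 : R) - z.2|%R)%:E)%E
            | gamma in [set gamma | coupling F1 F2 gamma]].

(* Main.v *)
Require Import Defs.
From HB Require Import structures.
From mathcomp Require Import all_boot all_order all_algebra.
From mathcomp Require Import all_classical all_reals all_analysis.
From mathcomp Require Import measurable_realfun ring lra.

Import Order.TTheory GRing.Theory Num.Theory.
Import numFieldNormedType.Exports.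

Local Open Scope classical_set_scope.
Local Open Scope ring_scope.

(* On the line W_1(F_n, F) is the integral of |F_n - F|: Tonelli's theorem gives
   the lower bound for every coupling, and the quantile coupling attains it.
   For a probability density v, Jensen's inequality bounds
   expR (lam * W_1(F_n, F)) by the v-average over s of
   expR (lam * |F_n s - F s| / v s), and a Chernoff bound follows by Tonelli.
   For fixed s, F_n s is a mean of i.i.d. Bernoulli variables whose parameter
   is within expR (- s^2 / (2 sigma^2)) of 0 or 1; with v of order s^-2 at
   infinity and lam at most n / (16 sigma) this Gaussian tail dominates
   expR (lam / (n * v s)), so the v-average has expectation at most
   2 * expR (512 * expR (- 3 / 2) * sigma^2 * lam^2 / n).  The factor 2 is
   absorbed by the shift 512 * sigma / sqrt n when choosing lam. *)

(** * Distances and couplings through indicators of half-lines *)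

Lemma measurable_fun_le_nat (R : realType) (d : measure_display)
    (T : measurableType d) (f : T -> R) : measurable_fun setT f ->
  measurable_fun setT
    (fun p : T * measurableTypeR R => (f p.1 <= p.2)%R%:R : R).
Proof.
move=> mf; apply: (eq_measurable_fun
  (fun p : T * measurableTypeR R => if f p.1 <= p.2 then 1 else 0 : R)).
  by move=> p _; case: ifPn.
apply: measurable_fun_ifT => //.
by apply: measurable_fun_ler => //; exact: measurableT_comp.
Qed.

(** For [x <= y] the integrand is the indicator of [x, y[, whose length is the distance. *)
Lemma dist_integral (R : realType) (x y : R) :
  (`|x - y|%:E =
   \int[lebesgue_measure]_s (`|(x <= s)%R%:R - (y <= s)%R%:R : R|)%:E)%E.
Proof.
wlog xy : x y / x <= y => [hw|].
  have [/hw//|/ltW/hw] := leP x y; rewrite distrC => ->.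
  by apply: eq_integral => s _; rewrite distrC.
transitivity (\int[lebesgue_measure]_s (\1_(`[x, y[%classic : set R) s)%:E)%E.
  transitivity (lebesgue_measure (`[x, y[%classic : set R)).
    rewrite lebesgue_measure_itv/= lte_fin ler0_norm ?subr_le0// opprB.
    case: ltP => [_|yx]; first by rewrite EFinB.
    by rewrite (le_anti (introT andP (conj xy yx))) subrr.
  by rewrite integral_indic// setIT.
apply: eq_integral => s _; rewrite indicE mem_setE in_itv/= ltNge.
have [xs|sx] := leP x s; have [ys|sy] := leP y s => /=;
  rewrite ?subrr ?subr0 ?normr0 ?normr1//.
by have := le_lt_trans xy (le_lt_trans ys sx); rewrite ltxx.
Qed.

Lemma integral_dist (R : realType) (d : measure_display)
    (T : measurableType d) (P : probability T R) (f g : T -> R) :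
    measurable_fun setT f -> measurable_fun setT g ->
  (\int[P]_w `|f w - g w|%:E = \int[lebesgue_measure]_s
     \int[P]_w (`|(f w <= s)%R%:R - (g w <= s)%R%:R : R|)%:E)%E.
Proof.
move=> mf mg; under eq_integral do rewrite dist_integral.
rewrite (fubini_tonelli (fun p : T * measurableTypeR R =>
  (`|(f p.1 <= p.2)%R%:R - (g p.1 <= p.2)%R%:R : R|)%:E))//.
apply/measurable_EFinP; apply: measurableT_comp => //.
by apply: measurable_funB; exact: measurable_fun_le_nat.
Qed.

Lemma measurable_sublevel (R : realType) (d : measure_display)
    (T : measurableType d) (f : T -> R) (s : R) :
  measurable_fun setT f -> measurable [set w | f w <= s].
Proof.
move=> mf; rewrite (_ : mkset _ = f @^-1` `]-oo, s]).
  by rewrite -[X in measurable X]setTI; exact: mf.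
by apply/seteqP; split => w /=; rewrite in_itv.
Qed.

Lemma integral_le_nat (R : realType) (d : measure_display)
    (T : measurableType d) (P : probability T R) (f : T -> R) (s : R) :
    measurable_fun setT f ->
  (\int[P]_w ((f w <= s)%R%:R : R)%:E = P [set w | (f w <= s)%R])%E.
Proof.
move=> mf; transitivity (\int[P]_w (\1_[set w | (f w <= s)%R] w)%:E)%E.
  by apply: eq_integral => w _; rewrite indicE mem_setE.
by rewrite integral_indic ?setIT//; exact: measurable_sublevel.
Qed.

Lemma integrable_le_nat (R : realType) (d : measure_display)
    (T : measurableType d) (P : probability T R) (f : T -> R) (s : R) :
    measurable_fun setT f ->
  P.-integrable setT (EFin \o (fun w => (f w <= s)%R%:R : R)).
Proof.
move=> mf; apply: measurable_bounded_integrable => //.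
- by rewrite (le_lt_trans (probability_le1 _ _)) ?ltry.
- exact: (measurableT_comp (measurable_fun_le_nat _ _ _ _ mf)
    (pair2_measurable (s : measurableTypeR R))).
- exists 1; split; rewrite ?num_real// => x x1 w _ /=.
  by rewrite ger0_norm// (le_trans _ (ltW x1))// lern1 leq_b1.
Qed.

Lemma measurable_fun_prob_le (R : realType) (d : measure_display)
    (T : measurableType d) (P : probability T R) (f : T -> R) :
    measurable_fun setT f ->
  measurable_fun setT (fun s : measurableTypeR R => P [set w | (f w <= s)%R]).
Proof.
move=> mf; under eq_fun do rewrite -integral_le_nat//.
apply: (measurable_fun_fubini_tonelli_G
  (fun p : T * measurableTypeR R => ((f p.1 <= p.2)%R%:R : R)%:E)) => //.
by apply/measurable_EFinP; exact: measurable_fun_le_nat.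
Qed.

Lemma prob_le_dist_le (R : realType) (d : measure_display)
    (T : measurableType d) (P : probability T R) (f g : T -> R) (s : R) :
    measurable_fun setT f -> measurable_fun setT g ->
  (`|P [set w | (f w <= s)%R] - P [set w | (g w <= s)%R]|
   <= \int[P]_w (`|(f w <= s)%R%:R - (g w <= s)%R%:R : R|)%:E)%E.
Proof.
move=> mf mg; rewrite -!integral_le_nat// -integralB_EFin//;
  [|exact: integrable_le_nat..].
apply: le_trans (le_abse_integral _ _ _) _ => //.
apply: emeasurable_funB; apply: measurable_int; exact: integrable_le_nat.
Qed.

(** When the two sublevel events are nested, the difference of their indicators has constant sign,
    so the triangle inequality of [prob_le_dist_le] is an equality. This is what makes the quantile
    coupling optimal. *)
Lemma prob_le_dist_nested (R : realType) (d : measure_display)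
    (T : measurableType d) (P : probability T R) (f g : T -> R) (s : R) :
    measurable_fun setT f -> measurable_fun setT g ->
    (forall w, f w <= s -> g w <= s) ->
  (\int[P]_w (`|(f w <= s)%R%:R - (g w <= s)%R%:R : R|)%:E
   = `|P [set w | (f w <= s)%R] - P [set w | (g w <= s)%R]|)%E.
Proof.
move=> mf mg fg.
transitivity (\int[P]_w
    (((g w <= s)%R%:R : R)%:E - ((f w <= s)%R%:R : R)%:E))%E.
  apply: eq_integral => w _; congr EFin; move: (fg w).
  case: (f w <= s) => [/(_ isT) ->|_]; first by rewrite subrr normr0.
  by case: (g w <= s); rewrite ?subr0 ?sub0r ?normrN ?normr1 ?normr0.
rewrite integralB_EFin//; [|exact: integrable_le_nat..].
rewrite !integral_le_nat// lee0_abs.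
  rewrite fin_num_oppeB ?fin_num_measure//; last exact: measurable_sublevel.
  by rewrite addeC.
rewrite sube_le0; apply: le_measure; rewrite ?inE;
  [exact: measurable_sublevel..|by move=> w; exact: fg].
Qed.

(** After Tonelli the cost is an integral over thresholds s, and at each s the triangle inequality
    bounds it below by the gap between the marginals. *)
Lemma dist_cdf_le_cost (R : realType) (F1 F2 : R -> \bar R)
    (gamma : probability (measurableTypeR R * measurableTypeR R)%type R) :
    coupling F1 F2 gamma ->
  (\int[lebesgue_measure]_s `|F1 s - F2 s|
   <= \int[gamma]_z (`|(z.1 : R) - z.2|%R)%:E)%E.
Proof.
move=> [h1 h2].
have m1 : measurable_fun setT
  (fst : measurableTypeR R * measurableTypeR R -> R) by exact: measurable_fst.
have m2 : measurable_fun setT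
  (snd : measurableTypeR R * measurableTypeR R -> R) by exact: measurable_snd.
rewrite (integral_dist _ _ _ _ _ _ m1 m2).
apply: ge0_le_integral => //.
- apply: measurableT_comp => //; apply: emeasurable_funB.
  apply: (eq_measurable_fun (fun s : measurableTypeR R =>
      gamma [set z | (z.1 <= s)%R])) => [s _|]; first exact: h1.
    exact: measurable_fun_prob_le.
  apply: (eq_measurable_fun (fun s : measurableTypeR R =>
      gamma [set z | (z.2 <= s)%R])) => [s _|]; first exact: h2.
    exact: measurable_fun_prob_le.
- apply: (measurable_fun_fubini_tonelli_G (fun p :
    (measurableTypeR R * measurableTypeR R) * measurableTypeR R =>
    (`|(p.1.1 <= p.2)%R%:R - (p.1.2 <= p.2)%R%:R : R|)%:E)) => //.
  apply/measurable_EFinP; apply: measurableT_comp => //.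
  by apply: measurable_funB; exact: (measurable_fun_le_nat _ _ _ _ _).
- by move=> s _; rewrite -h1 -h2; exact: prob_le_dist_le.
Qed.

(** * Quantile transform of a uniform variable, and the optimal coupling *)

Lemma uniform_prob_le (R : realType) (ab : (0 : R) < 1) (c : R) :
  0 <= c <= 1 -> uniform_prob ab [set u : R | 0 < u < 1 /\ u <= c] = c%:E.
Proof.
move=> /andP[c0 c1].
(* At c = 1 the constraint u < 1 leaves the right end open; below 1 it stays closed. *)
have -> : [set u : R | 0 < u < 1 /\ u <= c] =
    if c == 1 then `]0, 1[%classic else `]0, c]%classic.
  apply/seteqP; split => u /=.
    move=> [/andP[u0 u1] uc]; case: ifPn => _; rewrite /= in_itv/= ?u0//.
  case: eqP => [->|/eqP cn1] /=; rewrite in_itv/= => /andP[u0 u1].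
    by rewrite u0 u1 ltW.
  by rewrite u0 u1 (le_lt_trans u1) // lt_neqAle cn1.
have H (S : set R) : measurable S -> S `<=` `[0, 1] ->
    uniform_prob ab S = lebesgue_measure S.
  move=> mS S01; rewrite /uniform_prob.
  rewrite (eq_integral (fun=> 1%:E)).
    by rewrite integral_cst// mul1e.
  move=> u /set_mem /S01 /=; rewrite in_itv/= /uniform_pdf => ->.
  by rewrite subr0 invr1.
case: eqP => [->|_]; rewrite H//.
- by rewrite lebesgue_measure_itv/= lte_fin ltr01 oppr0 adde0.
- by apply: subset_itv; rewrite bnd_simp.
- rewrite lebesgue_measure_itv/= lte_fin; case: ltP => c0';
    rewrite ?oppr0 ?adde0//.
  by congr EFin; apply/le_anti; rewrite c0 c0'.
- by apply: subset_itv; rewrite bnd_simp.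
Qed.

(** The Galois connection that characterizes the generalized inverse of a distribution function. The
    levels 0 and 1 are excluded, since there the inverse may be infinite. *)
Definition quantile (R : realType) (F Q : R -> R) : Prop :=
  forall u s : R, 0 < u < 1 -> (Q u <= s) = (u <= F s).
Arguments quantile {R}.

Lemma measurable_fun_sublevel (R : realType) (d : measure_display)
    (T : measurableType d) (f : T -> R) :
  (forall s, measurable [set w | f w <= s]) -> measurable_fun setT f.
Proof.
move=> mf; apply: (measurability (@RGenOInfty.G R)) => [|/= _ [_] [r] -> <-].
  exact: RGenOInfty.measurableE.
rewrite setTI (_ : _ @^-1` _ = ~` [set w | f w <= r]).
  exact/measurableC/mf.
by apply/seteqP; split => w /=; rewrite in_itv/= andbT ltNge => /negP.
Qed.

Section quantile_transform.
Variables (R : realType) (F Q : R -> R).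
Hypotheses (F01 : forall s, 0 <= F s <= 1) (FQ : quantile F Q).

(** [Q] is arbitrary outside ]0, 1[; the default 0 makes the function measurable and changes it only
    on a null set of the uniform law. *)
Let q (u : R) : R := if 0 < u < 1 then Q u else 0.

(** The second set is the complement of ]0, 1[, present exactly when the default value 0 lies below
    s. Writing it with [u <= 1] gives it the shape handled by [uniform_prob_le] at c = 1. *)
Lemma quantile_sublevel s : [set u | q u <= s] =
  [set u : R | 0 < u < 1 /\ u <= F s] `|`
  (if 0 <= s then ~` [set u : R | 0 < u < 1 /\ u <= 1] else set0).
Proof.
apply/seteqP; split => u /=; rewrite /q.
  case: ifPn => [u01|nu01]; first by rewrite FQ// => us; left.
  by move=> ->; right => -[]; rewrite (negbTE nu01).
move=> [[u01]|]; first by rewrite u01 FQ.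
case: ifPn => //= s0; case: ifPn => // u01 []; split => //.
by case/andP: u01 => _ /ltW.
Qed.

Let measurable_01_le (c : R) : measurable [set u : R | 0 < u < 1 /\ u <= c].
Proof.
rewrite (_ : mkset _ = `]0, 1[%classic `&` `]-oo, c]%classic).
  exact: measurableI.
by apply/seteqP; split => u /=; rewrite !in_itv.
Qed.

Let measurable_tail (s : R) : measurable
  (if 0 <= s then ~` [set u : R | 0 < u < 1 /\ u <= 1] else set0).
Proof. by case: (0 <= s) => //; exact: measurableC. Qed.

Lemma measurable_quantile : measurable_fun setT q.
Proof.
apply: measurable_fun_sublevel => s; rewrite quantile_sublevel.
by apply: measurableU.
Qed.

Lemma uniform_quantile (ab : (0 : R) < 1) s :
  uniform_prob ab [set u | q u <= s] = (F s)%:E.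
Proof.
rewrite quantile_sublevel measureU0//.
- exact: (uniform_prob_le R ab (F s) (F01 s)).
- exact: measurable_01_le.
- exact: measurable_tail.
- case: (0 <= s); last exact: measure0.
  apply: (etrans (probability_setC (uniform_prob ab) (measurable_01_le 1))).
  rewrite -[X in (_ - X)%E](_ : 1%:E = _) ?subee//; apply/esym.
  by apply: (uniform_prob_le R ab 1); rewrite ler01 lexx.
Qed.

End quantile_transform.

Lemma wasserstein1_quantile (R : realType) (F1 F2 Q1 Q2 : R -> R) :
    (forall s, 0 <= F1 s <= 1) -> (forall s, 0 <= F2 s <= 1) ->
    quantile F1 Q1 -> quantile F2 Q2 ->
  wasserstein1 (fun s => (F1 s)%:E) (fun s => (F2 s)%:E)
    = (\int[lebesgue_measure]_s `|F1 s - F2 s|%:E)%E.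
Proof.
move=> F1_01 F2_01 hQ1 hQ2; apply/le_anti/andP; split; last first.
  apply: le_ereal_inf_tmp => _ [gamma hg <-].
  by have := dist_cdf_le_cost _ _ _ _ hg.
have ab : (0 : R) < 1 by [].
set q1 := fun u => if 0 < u < 1 then Q1 u else 0.
set q2 := fun u => if 0 < u < 1 then Q2 u else 0.
have mq1 : measurable_fun setT q1 by exact: measurable_quantile hQ1.
have mq2 : measurable_fun setT q2 by exact: measurable_quantile hQ2.
have mq : measurable_fun setT ((fun u => (q1 u, q2 u)) :
    measurableTypeR R -> measurableTypeR R * measurableTypeR R).
  exact: measurable_fun_pair.
pose q : {mfun measurableTypeR R >->
  (measurableTypeR R * measurableTypeR R)%type} :=
  @mfun_Sub _ _ (measurableTypeR R) (measurableTypeR R * measurableTypeR R)%type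
    _ (mem_set mq).
(* The quantile coupling: both coordinates are driven by the same uniform variable. *)
pose gamma : probability (measurableTypeR R * measurableTypeR R)%type R :=
  distribution (uniform_prob ab) q.
apply: ge_ereal_inf; exists (\int[gamma]_z
   (`|(z.1 : R) - z.2|%R)%:E)%E.
  exists gamma => //; split => t.
    exact: (uniform_quantile _ _ _ F1_01 hQ1 ab).
  exact: (uniform_quantile _ _ _ F2_01 hQ2 ab).
rewrite ge0_integral_distribution//.
  rewrite /= (integral_dist _ _ _ (uniform_prob ab) q1 q2 mq1 mq2).
  rewrite le_eqVlt; apply/orP; left; apply/eqP; apply: eq_integral => s _.
  (* For each fixed s the sublevel events of [q1] and [q2] are nested, in a direction given by the
     order of [F1 s] and [F2 s]; by symmetry one direction suffices. *)
  wlog le12 : F1 F2 Q1 Q2 hQ1 hQ2 F1_01 F2_01 @q1 @q2 mq1 mq2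
      {mq q gamma} / F1 s <= F2 s.
    move=> hw; have [/hw|/ltW/hw] := leP (F1 s) (F2 s); first exact.
    move=> h; rewrite distrC -(h Q2 Q1)//.
    by apply: eq_integral => u _; rewrite distrC.
  have q12 u : q1 u <= s -> q2 u <= s.
    rewrite /q1 /q2; case: ifPn => // u01.
    by rewrite hQ1// hQ2// => /le_trans; apply.
  rewrite (prob_le_dist_nested _ _ _ (uniform_prob ab) q1 q2 s mq1 mq2 q12).
  transitivity (`|(F1 s)%:E - (F2 s)%:E|)%E => //; congr (`|_ - _|)%E.
    exact: (uniform_quantile _ _ _ F1_01 hQ1 ab).
  exact: (uniform_quantile _ _ _ F2_01 hQ2 ab).
apply/measurable_EFinP; apply: measurableT_comp => //.
exact: measurable_funB measurable_fst measurable_snd.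
Qed.

(** * Existence of quantile functions *)

Lemma quantile_cdf (R : realType) (d : measure_display)
    (T : measurableType d) (P : probability T R) (X : {RV P >-> R}) :
  exists Q, quantile (fun s => fine (cdf X s)) Q.
Proof.
suff H (u : R) : exists q,
    0 < u < 1 -> forall s, (q <= s) = (u <= fine (cdf X s)).
  by have [Q hQ] := choice H; exists Q => u s /hQ.
have [u01|] := boolP (0 < u < 1); last by exists 0.
have /andP[u0 u1] := u01; pose F s := fine (cdf X s).
have ndF : {homo F : s t / s <= t}.
  move=> s t st; rewrite fine_le ?fin_num_measure//.
  exact: cdf_nondecreasing.
have [M FM] : exists M, u < F M.
  have /cvgr_gt/(_ u u1) : F @ +oo --> (1 : R).
    by apply: fine_cvg; exact: cvg_cdfy1.
  case=> M [_ /(_ (M + 1))]; rewrite ltrDl ltr01 => /(_ isT) ?.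
  by exists (M + 1).
have [m Fm] : exists m, F m < u.
  have /cvgr_lt/(_ u u0) : F @ -oo --> (0 : R).
    by apply: fine_cvg; exact: cvg_cdfNy0.
  case=> m [_ /(_ (m - 1))]; rewrite ltrBlDr ltrDl ltr01 => /(_ isT) ?.
  by exists (m - 1).
(* The quantile is [inf A]: the limit 1 at +oo makes [A] nonempty, the limit 0 at -oo bounds it
   below. *)
pose A := [set s | u <= F s].
have lbA : lbound A m.
  move=> s /= us; rewrite leNgt; apply/negP => /ltW/ndF/(le_trans us).
  by rewrite leNgt Fm.
have A0 : A !=set0 by exists M => /=; exact: ltW.
exists (inf A) => _ s; apply/idP/idP => [infs|us]; last first.
  by apply: ge_inf => //; exists m.
apply: (le_trans _ (ndF _ _ infs)).
(* Right continuity makes the infimum attained: [F] is at least u everywhere to the right of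
   [inf A], hence also at it. *)
have rc : F x @[x --> (inf A)^'+] --> F (inf A).
  apply: fine_cvg; rewrite fineK ?fin_num_measure//.
  exact: cdf_right_continuous.
apply: (cvgr_to_ge rc); near=> x.
have xA : inf A < x by near: x; exact: nbhs_right_gt.
have [||y Ay yx] := @inf_adherent _ A (x - inf A).
- by rewrite subr_gt0.
- by split => //; exists m.
- by apply: (le_trans Ay); apply/ndF/ltW; rewrite addrC subrK in yx.
Unshelve. all: by end_near. Qed.

Lemma quantile_empirical (R : realType) (n : nat) (x : 'I_n -> R) :
    (0 < n)%N ->
  exists Q, quantile (fun t => n%:R^-1 * \sum_(i < n) (x i <= t)%R%:R) Q.
Proof.
move=> n0; pose F t : R := n%:R^-1 * \sum_(i < n) (x i <= t)%R%:R.
suff H (u : R) : exists q, 0 < u < 1 -> forall s, (q <= s) = (u <= F s).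
  by have [Q hQ] := choice H; exists Q => u s /hQ.
have ndF : {homo F : s t / s <= t}.
  move=> s t st; rewrite ler_wpM2l ?invr_ge0//; apply: ler_sum => i _.
  by rewrite ler_nat; case: leP => // /le_trans -> .
(* A positive value of the step function is already reached at the largest sample below s, so the
   quantile can be sought among the samples, as the least one with [u <= F (x j)]. *)
have atom s : 0 < F s -> exists2 j, x j <= s & F s = F (x j).
  move=> Fs; have [i0 xi0] : exists i, x i <= s.
    apply: contrapT => /forallNP h; move: Fs.
    rewrite /F big1 ?mulr0 ?ltxx// => i _.
    by have /negP/negbTE -> := h i.
  case: (@arg_maxP _ _ _ i0 (fun i => x i <= s) x xi0) => j xj xmax.
  exists j => //; congr (_ * _); apply: eq_bigr => i _.
  congr (nat_of_bool _)%:R.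
  by apply/idP/idP => [/xmax//|/le_trans]; apply.
have [[u01 [i0 ui0]]|H] := pselect (0 < u < 1 /\ exists i, u <= F (x i)).
  case: (@arg_minP _ _ _ i0 (fun i => u <= F (x i)) x ui0) => j uj xmin.
  exists (x j) => _ s; apply/idP/idP => [/ndF|us]; first exact: le_trans.
  have [|k xk Fs] := atom s; first by case/andP: u01 => /lt_le_trans + _; apply.
  by rewrite (le_trans _ xk)// xmin// -Fs.
(* For u in ]0, 1[ a suitable sample always exists: [F] equals 1 at the largest one. *)
exists 0 => u01; exfalso; apply: H; split => //.
case: (@arg_maxP _ _ _ (Ordinal n0) predT x isT) => j _ xmax; exists j.
have {}xmax i : x i <= x j by exact: xmax.
rewrite /F (eq_bigr (fun=> 1)) => [|i _]; last by rewrite xmax.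
rewrite sumr_const card_ord mulVf ?pnatr_eq0 -?lt0n//.
by case/andP: u01 => _ /ltW.
Qed.

(** * Moment generating function of a centred Bernoulli variable *)

Lemma is_derive_ge0_ndecr (R : realType) (f df : R -> R) :
    (forall x, is_derive x (1 : R) f (df x)) ->
    (forall x, 0 < x -> 0 <= df x) ->
  forall x, 0 <= x -> f 0 <= f x.
Proof.
move=> fdf df0 x x0; apply: (@ger0_derive1_le_cc _ f 0 x) => //.
- move=> y; rewrite in_itv/= => /andP[y0 _].
  by rewrite derive1E (@derive_val _ _ _ _ _ _ _ (fdf y)) df0.
- apply: derivable_within_continuous => y _.
  exact: (@ex_derive _ _ _ _ _ _ _ (fdf y)).
- by rewrite in_itv/= lexx.
- by rewrite in_itv/= lexx andbT.
Qed.

Lemma expR_le_quadratic (R : realType) (x : R) :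
  expR x <= 1 + x + x ^+ 2 / 2 * expR `|x|.
Proof.
have [x0|x0] := leP 0 x.
  (* The claim divided by [expR y]: the derivative is [y * (1 - expR (- y))] and the value at 0 is
     1. *)
  pose f (y : R) := (1 + y) * expR (- y) + y ^+ 2 / 2.
  have h : f 0 <= f x.
    apply: (is_derive_ge0_ndecr _ _ (fun y => y * (1 - expR (- y)))) => // y.
      by apply: is_derive_eq; rewrite /GRing.scale/=; field.
    move=> y0; rewrite mulr_ge0 ?(ltW y0)// subr_ge0 -expR0 ler_expR; lra.
  rewrite ger0_norm//.
  have := ler_wpM2r (expR_ge0 x) h.
  rewrite /f oppr0 expR0 addr0 mulr1 expr0n/= mul0r addr0.
  rewrite mul1r [leRHS]mulrDl -[(1 + x) * _ * _]mulrA.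
  by rewrite -expRD addNr expR0 mulr1.
(* For negative x the bound holds even without the factor [expR |x|], which is at least 1. *)
pose f (y : R) := 1 - y + y ^+ 2 / 2 - expR (- y).
have h : f 0 <= f (- x).
  apply: (is_derive_ge0_ndecr _ _ (fun y => - 1 + y + expR (- y))) => [y|y y0|].
  - by apply: is_derive_eq; rewrite /GRing.scale/=; field.
  - by have := expR_ge1Dx (- y); lra.
  - lra.
have : 1 <= expR `|x| by rewrite -expR0 ler_expR.
have : 0 <= x ^+ 2 by exact: sqr_ge0.
rewrite /f oppr0 expR0 expr0n/= mul0r !addr0 subrr !opprK sqrrN in h; nra.
Qed.

(** The centring factor [expR (- (a * p))] cancels the linear term of [expR_le_quadratic]. The
    exponent keeps the factor p, which a Hoeffding bound would lose; through it the Gaussian tail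
    enters. *)
Lemma bernoulli_mgf (R : realType) (p a : R) : 0 <= p <= 1 ->
  p * expR (a * (1 - p)) + (1 - p) * expR (a * (0 - p))
    <= expR (p * (a ^+ 2 / 2 * expR `|a|)).
Proof.
move=> /andP[p0 p1].
have -> : p * expR (a * (1 - p)) + (1 - p) * expR (a * (0 - p)) =
    expR (- (a * p)) * (1 + p * (expR a - 1)).
  by rewrite mulrBr mulr1 sub0r mulrN expRD; ring.
have e1 : 1 + p * (expR a - 1) <= expR (p * (a + a ^+ 2 / 2 * expR `|a|)).
  apply: le_trans (expR_ge1Dx _); rewrite lerD2l ler_wpM2l//.
  by have := expR_le_quadratic _ a; lra.
apply: le_trans (ler_wpM2l (expR_ge0 _) e1) _.
rewrite -expRD ler_expR; lra.
Qed.

(* The case 1 - p <= r is bernoulli_mgf at 1 - p and - a. *)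
Lemma bernoulli_mgf_min (R : realType) (p a r : R) :
    0 <= p <= 1 -> p <= r \/ 1 - p <= r ->
  p * expR (a * (1 - p)) + (1 - p) * expR (a * (0 - p))
    <= expR (r * (a ^+ 2 / 2 * expR `|a|)).
Proof.
move=> p01 pr; have a0 : 0 <= a ^+ 2 / 2 * expR `|a|.
  by rewrite mulr_ge0 ?expR_ge0// divr_ge0// sqr_ge0.
case: pr => h.
  by apply: le_trans (bernoulli_mgf _ _ _ p01) _; rewrite ler_expR ler_wpM2r.
have q01 : 0 <= 1 - p <= 1 by lra.
have := bernoulli_mgf _ _ (- a) q01; rewrite normrN sqrrN => H.
apply: le_trans (le_trans H _); last by rewrite ler_expR ler_wpM2r.
rewrite le_eqVlt; apply/orP; left; apply/eqP; rewrite addrC.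
by congr (_ * expR _ + _ * expR _); ring.
Qed.

(** * Exponential moments of the empirical process at a fixed point *)

Section iid.
Variables (R : realType) (d : measure_display) (T : measurableType d)
  (P : probability T R) (n : nat) (Xs : 'I_n -> {RV P >-> R}) (F : R -> R).
Hypothesis Xs_iid : iid_samples Xs (fun s => (F s)%:E).

Let measurable_Xs i : measurable_fun setT (Xs i).
Proof. exact: measurable_funPT. Qed.

Lemma prob_iid_le i s : P [set w | (Xs i w <= s)%R] = (F s)%:E.
Proof.
rewrite -(congr1 (@^~ s) (Xs_iid.2 i)) /cdf /distribution /pushforward /=.
by congr (P _); apply/seteqP; split => w /=; rewrite in_itv.
Qed.

Lemma prob_iid_gt i s : P [set w | (Xs i w <= s)%R = false] = (1 - F s)%:E.
Proof.
rewrite EFinB -(prob_iid_le i) -probability_setC;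
  last exact: measurable_sublevel.
by congr (P _); apply/seteqP; split => w /=; [move=> ->|move/negP/negbTE].
Qed.

(** The product depends only on the boolean pattern of the comparisons with s. Summing over patterns
    turns independence on events into the product rule for expectations. *)
Lemma iid_prod_expectation (c : bool -> R) s : (forall b, 0 <= c b) ->
  (\int[P]_w (\prod_(i < n) c (Xs i w <= s)%R)%:E =
   ((F s * c true + (1 - F s) * c false) ^+ n)%:E)%E.
Proof.
move=> c0; pose B b : set R := [set x | (x <= s) = b].
have mle : measurable [set x : R | x <= s].
  rewrite (_ : mkset _ = `]-oo, s]%classic); first exact: measurable_itv.
  by apply/seteqP; split => x /=; rewrite in_itv.
have mB b : measurable (B b).
  case: b; first exact: mle.
  rewrite (_ : B false = ~` [set x | x <= s]); first exact: measurableC.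
  by apply/seteqP; split => w /=; rewrite /B/= ; [move=> ->|move/negP/negbTE].
pose E (f : {ffun 'I_n -> bool}) := [set w | forall i, B (f i) (Xs i w)].
have mE f : measurable (E f).
  rewrite (_ : E f = \bigcap_(i in setT) (Xs i @^-1` B (f i))).
    apply: fin_bigcap_measurable => // i _.
    by rewrite -[X in measurable X]setTI; exact: measurable_Xs.
  by apply/seteqP; split => w /= h i; [move=> _|]; exact: h.
have prodE w : \prod_(i < n) c (Xs i w <= s) =
    \sum_(f : {ffun 'I_n -> bool}) (\prod_(i < n) c (f i)) * \1_(E f) w.
  rewrite (bigD1 [ffun i => Xs i w <= s])//= [X in _ + X]big1 => [|f /eqP fn].
    rewrite addr0 indicE mem_set ?mulr1.
      by apply: eq_bigr => i _; rewrite ffunE.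
    by move=> i; rewrite /B/= ffunE.
  rewrite indicE memNset ?mulr0// => Ef; apply: fn; apply/ffunP => i.
  by rewrite ffunE; exact/esym/Ef.
under eq_integral do rewrite prodE -sumEFin.
rewrite ge0_integral_sum//; last 2 first.
- by move=> f; apply/measurable_EFinP; exact: measurable_funM.
- by move=> f w _; rewrite lee_fin mulr_ge0// prodr_ge0.
rewrite (eq_bigr (fun f : {ffun 'I_n -> bool} =>
  (\prod_(i < n) (c (f i) * (if f i then F s else 1 - F s)))%:E)) => [|f _].
  (* Distributivity read backwards: the sum over patterns of products is the product of two-term
     sums. *)
  rewrite sumEFin -(bigA_distr_bigA (fun (i : 'I_n) b =>
    c b * (if b then F s else 1 - F s))).
  rewrite (eq_bigr (fun=> F s * c true + (1 - F s) * c false)) => [|i _].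
    by rewrite prodr_const card_ord.
  by rewrite big_bool/= ![c _ * _]mulrC.
under eq_integral do rewrite EFinM.
rewrite ge0_integralZl//; last 2 first.
- exact/measurable_EFinP/measurable_indic.
- by rewrite lee_fin prodr_ge0.
have PE : P (E f) = (\prod_(i < n) P (Xs i @^-1` B (f i)))%E :=
  Xs_iid.1 _ (fun i => mB (f i)).
rewrite integral_indic// setIT big_split EFinM; congr (_ * _)%E.
apply: etrans PE _; rewrite -prodEFin; apply: eq_bigr => i _.
rewrite /preimage /B; case: (f i).
- exact: prob_iid_le.
- exact: prob_iid_gt.
Qed.

Lemma iid_exp_dev (a s r : R) : 0 <= F s <= 1 -> F s <= r \/ 1 - F s <= r ->
  (\int[P]_w (expR (a * \sum_(i < n) ((Xs i w <= s)%R%:R - F s)))%:E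
   <= (expR (n%:R * (r * (a ^+ 2 / 2 * expR `|a|))))%:E)%E.
Proof.
move=> F01 Fr; pose c b := expR (a * (b%:R - F s)).
rewrite (eq_integral (fun w => (\prod_(i < n) c (Xs i w <= s)%R)%:E)) => [|w _].
  rewrite (iid_prod_expectation c) => [|b]; last exact: expR_ge0.
  rewrite lee_fin expRM_natl lerXn2r ?nnegrE ?expR_ge0//.
    by case/andP: F01 => *; rewrite addr_ge0// mulr_ge0 ?expR_ge0// subr_ge0.
  exact: bernoulli_mgf_min.
by rewrite mulr_sumr expR_sum.
Qed.

End iid.

(** * Chernoff bound for an integral over the line *)

(* Jensen's inequality for the weight v = 1 / k in its tangent line form:
   1 + h <= expR h, integrated against v. *)
Lemma chernoff_integral (R : realType) (d : measure_display)
    (T : measurableType d) (P : probability T R)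
    (g : T * measurableTypeR R -> R) (v k : measurableTypeR R -> R)
    (eps lam M : R) :
    measurable_fun setT g -> (forall x, 0 <= g x) ->
    measurable_fun setT v -> measurable_fun setT k ->
    (forall s, 0 < v s) -> (forall s, v s * k s = 1) ->
    (\int[lebesgue_measure]_s (v s)%:E = 1)%E ->
    0 <= eps -> 0 < lam ->
    (forall s, \int[P]_w (expR (lam * (g (w, s) * k s)))%:E <= M%:E)%E ->
  (P [set w | eps%:E < \int[lebesgue_measure]_s (g (w, s))%:E]
   <= (expR (- (lam * eps)) * M)%:E)%E.
Proof.
move=> mg g0 mv mk v0 vk v1 eps0 lam0 HM.
set A := [set w | _].
have mint : measurable_fun setT
    (fun w => \int[lebesgue_measure]_s (g (w, s))%:E)%E.
  apply: (measurable_fun_fubini_tonelli_F (fun x => (g x)%:E)) => //.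
  exact/measurable_EFinP.
have mA : measurable A.
  by rewrite -[A]setTI; apply: emeasurable_fun_o_infty.
have mv2 : measurable_fun setT (fun x : T * measurableTypeR R => v x.2).
  exact: measurableT_comp mv measurable_snd.
have mk2 : measurable_fun setT (fun x : T * measurableTypeR R => k x.2).
  exact: measurableT_comp mk measurable_snd.
pose f (x : T * measurableTypeR R) : R :=
  v x.2 * expR (lam * (g x * k x.2) - lam * eps).
have mf : measurable_fun setT f.
  apply: measurable_funM => //; apply: measurableT_comp => //.
  apply: measurable_funB => //; apply: measurable_funM => //.
  exact: measurable_funM.
have f0 x : 0 <= f x by rewrite mulr_ge0 ?expR_ge0// ltW.
have mfw w : measurable_fun setT (fun s : measurableTypeR R => f (w, s)).
  exact: measurableT_comp mf (pair1_measurable w).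
have mgw w : measurable_fun setT (fun s : measurableTypeR R => g (w, s)).
  exact: measurableT_comp mg (pair1_measurable w).
have M0 : (0 <= M%:E)%E.
  apply: le_trans (HM 0); apply: integral_ge0 => w _.
  by rewrite lee_fin expR_ge0.
(* The Markov step: the indicator of [A] is below the integral of [f]. Adding [lam * eps] to both
   sides keeps every integrand nonnegative. *)
have A1 w : A w -> (1 <= \int[lebesgue_measure]_s (f (w, s))%:E)%E.
  rewrite /A/= => Aw.
  have le0 : (0 <= (lam * eps)%:E)%E by rewrite lee_fin mulr_ge0// ltW.
  rewrite -(leeD2rE _ _ (_ : (lam * eps)%:E \is a fin_num))//.
  apply: (@le_trans _ _ (\int[lebesgue_measure]_s
      ((v s)%:E + lam%:E * (g (w, s))%:E))%E).
    rewrite ge0_integralD//; last 4 first.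
    - by move=> s _; rewrite lee_fin ltW.
    - exact/measurable_EFinP.
    - by move=> s _; rewrite -EFinM lee_fin mulr_ge0// ltW.
    - by apply: measurable_funeM; exact/measurable_EFinP.
    rewrite v1 leeD2l// ge0_integralZl//; last 3 first.
    - exact/measurable_EFinP.
    - by move=> s _; rewrite lee_fin.
    - by rewrite lee_fin ltW.
    by rewrite EFinM lee_wpmul2l ?lee_fin ?(ltW lam0) ?(ltW Aw).
  apply: (@le_trans _ _ (\int[lebesgue_measure]_s
      ((f (w, s))%:E + (lam * eps)%:E * (v s)%:E))%E).
    apply: ge0_le_integral => //.
    - by move=> s _; rewrite adde_ge0// ?mule_ge0 ?lee_fin;
        rewrite ?(ltW lam0) ?(ltW (v0 s)).
    - apply: emeasurable_funD; first exact/measurable_EFinP.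
      by apply: measurable_funeM; exact/measurable_EFinP.
    - apply: emeasurable_funD; first exact/measurable_EFinP.
      by apply: measurable_funeM; exact/measurable_EFinP.
    - move=> s _; rewrite -!EFinM -!EFinD lee_fin /f/=.
      have := ler_wpM2l (ltW (v0 s))
        (expR_ge1Dx (lam * (g (w, s) * k s) - lam * eps)).
      rewrite (_ : v s * (1 + _) = v s - lam * eps * v s
        + lam * g (w, s) * (v s * k s)); last by ring.
      by rewrite vk; lra.
  rewrite ge0_integralD//; last 4 first.
  - by move=> s _; rewrite lee_fin.
  - exact/measurable_EFinP.
  - by move=> s _; rewrite -EFinM lee_fin mulr_ge0// ltW.
  - by apply: measurable_funeM; exact/measurable_EFinP.
  rewrite ge0_integralZl//; last 2 first.
  - exact/measurable_EFinP.
  - by move=> s _; rewrite lee_fin ltW.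
  by rewrite v1 mule1.
apply: (@le_trans _ _ (\int[P]_w \int[lebesgue_measure]_s (f (w, s))%:E)%E).
  apply: (@le_trans _ _ (\int[P]_w (\1_A w)%:E)%E).
    by rewrite integral_indic// setIT.
  apply: ge0_le_integral => //.
  - exact/measurable_EFinP/measurable_indic.
  - apply: (measurable_fun_fubini_tonelli_F (fun x => (f x)%:E)) => //.
    exact/measurable_EFinP.
  - move=> w _; rewrite indicE; case: (boolP (w \in A)) => [/set_mem/A1//|_].
    by apply: integral_ge0 => s _; rewrite lee_fin.
rewrite (fubini_tonelli (fun x => (f x)%:E))//; last exact/measurable_EFinP.
apply: (@le_trans _ _ (\int[lebesgue_measure]_s
    ((expR (- (lam * eps)) * M)%:E * (v s)%:E))%E).
  apply: ge0_le_integral => //.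
  - by move=> s _; apply: integral_ge0 => w _; rewrite lee_fin.
  - apply: (measurable_fun_fubini_tonelli_G (fun x => (f x)%:E)) => //.
    exact/measurable_EFinP.
  - by apply: measurable_funeM; exact/measurable_EFinP.
  - move=> s _.
    rewrite (eq_integral (fun w => (v s * expR (- (lam * eps)))%:E *
        (expR (lam * (g (w, s) * k s)))%:E)%E) => [|w _]; last first.
      by rewrite /f/= expRD -EFinM; congr EFin; ring.
    rewrite ge0_integralZl//; last 2 first.
    - apply/measurable_EFinP; apply: measurableT_comp => //.
      apply: measurable_funM => //; apply: measurable_funM => //.
      exact: measurableT_comp mg (pair2_measurable s).
    - by rewrite lee_fin mulr_ge0 ?expR_ge0// ltW.
    rewrite [leRHS](_ : _ = ((v s * expR (- (lam * eps)))%:E * M%:E)%E).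
      by rewrite lee_wpmul2l// lee_fin mulr_ge0 ?expR_ge0// ltW.
    by rewrite -!EFinM; congr EFin; ring.
rewrite ge0_integralZl//; last 3 first.
- exact/measurable_EFinP.
- by move=> s _; rewrite lee_fin ltW.
- by rewrite lee_fin mulr_ge0 ?expR_ge0.
by rewrite v1 mule1.
Qed.

(** * The weight of order s^-2 and the numerical estimates *)

Lemma continuous_weight (R : realType) (c : R) : 0 < c ->
  continuous (fun s : R => c / (2 * (c + `|s|) ^+ 2)).
Proof.
move=> c0 x; have cx0 : 0 < c + `|x| by rewrite ltr_wpDr.
apply: cvgM; first exact: cvg_cst.
apply: cvgV; first by rewrite mulf_neq0// expf_neq0// gt_eqF.
apply: cvgM; first exact: cvg_cst.
have cvgx : c + `|s| @[s --> x] --> c + `|x|.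
  by apply: cvgD; [exact: cvg_cst|exact: norm_continuous].
exact: (cvgM cvgx cvgx).
Qed.

(** By evenness this is twice the integral over the half-line, where the primitive
    [- (c / 2) / (c + s)] rises from -1/2 to 0. *)
Lemma integral_weight (R : realType) (c : R) : 0 < c ->
  (\int[lebesgue_measure]_s (c / (2 * (c + `|s|) ^+ 2))%:E = 1)%E.
Proof.
move=> c0; have cf : continuous (fun s : R => c / (2 * (c + `|s|) ^+ 2)).
  exact: continuous_weight.
rewrite ge0_symfun_integralT//; last 2 first.
- by move=> x; rewrite divr_ge0 ?(ltW c0)// mulr_ge0 ?sqr_ge0.
- by move=> x /=; rewrite normrN.
rewrite (_ : [set x | (0 <= x)%R] = `[0, +oo[%classic); last first.
  by apply/seteqP; split => x /=; rewrite in_itv/= andbT.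
have dF (x : R) : 0 < x ->
    is_derive x (1 : R) (fun s => - (c / 2) * (c + s)^-1)
      (c / (2 * (c + `|x|) ^+ 2)).
  move=> x0; have cx0 : c + x != 0 by rewrite gt_eqF// addr_gt0.
  apply: is_derive_eq; rewrite /GRing.scale/= gtr0_norm//.
  by field.
rewrite (@ge0_continuous_FTC2y _ _ (fun s => - (c / 2) * (c + s)^-1) 0 0).
- rewrite -EFinB -EFinM; congr EFin; field; exact: lt0r_neq0.
- by move=> x _; rewrite divr_ge0 ?(ltW c0)// mulr_ge0 ?sqr_ge0.
- exact: continuous_subspaceT.
- rewrite -[X in _ --> X](mulr0 (- (c / 2))); apply: cvgM; first exact: cvg_cst.
  apply/gtr0_cvgV0.
    by near=> x; rewrite addr_gt0//; near: x; exact: nbhs_pinfty_gt.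
  exact: cvg_addrl.
- by move=> x /dF h; exact: (@ex_derive _ _ _ _ _ _ _ h).
- apply: cvg_at_right_filter; apply: cvgM; first exact: cvg_cst.
  apply: cvgV; first by rewrite addr0 gt_eqF.
  by apply: cvgD; [exact: cvg_cst|exact: cvg_id].
- move=> x; rewrite in_itv/= andbT => /dF h.
  by rewrite derive1E (@derive_val _ _ _ _ _ _ _ h).
Unshelve. all: by end_near. Qed.

Lemma expR_half_ge (R : realType) : 8 / 5 <= expR (2^-1 : R).
Proof.
have h : (9 / 8 : R) <= expR 8^-1.
  by apply: le_trans (expR_ge1Dx _); lra.
have -> : (2^-1 : R) = 4%:R * 8^-1 by field.
rewrite expRM_natl; apply: (@le_trans _ _ ((9 / 8) ^+ 4)); first lra.
by rewrite lerXn2r ?nnegrE ?expR_ge0//; lra.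
Qed.

(** With y = 1 + u^2, the bound on m gives a <= y / 4, while the Gaussian factor is exp (1/2 - y/2).
    The remaining exp (1/2 - y/4) absorbs the y^2 coming from a^2. *)
Lemma gaussian_tail_mgf (R : realType) (m u a : R) :
    0 <= m <= 16^-1 -> 0 <= u -> a = 2 * m * (1 + u) ^+ 2 ->
  expR (- (u ^+ 2 / 2)) * (a ^+ 2 / 2 * expR a)
    <= 512 * expR (- 2^-1) ^+ 3 * m ^+ 2.
Proof.
move=> /andP[m0 m16] u0 aE.
pose y := 1 + u ^+ 2.
have y1 : 1 <= y by rewrite lerDl sqr_ge0.
have uy : (1 + u) ^+ 2 <= 2 * y.
  by rewrite /y; have := sqr_ge0 (1 - u); rewrite !expr2; lra.
have a0 : 0 <= a by rewrite aE mulr_ge0 ?sqr_ge0// mulr_ge0.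
have a4 : a <= 4 * m * y by rewrite aE; nra.
have ay : a <= y / 4 by nra.
have a2 : a ^+ 2 / 2 <= 8 * m ^+ 2 * y ^+ 2.
  have : a ^+ 2 <= (4 * m * y) ^+ 2 by rewrite lerXn2r ?nnegrE//; nra.
  by rewrite !exprMn; lra.
(* This is t <= exp (t - 1) at t = y / 8, squared; 8 * 64 and 1/2 - 2 produce the constants 512 and
   -3/2. *)
have yexp : y ^+ 2 <= 64 * expR (y / 4 - 2).
  have : (y / 8) ^+ 2 <= expR (y / 8 - 1) ^+ 2.
    rewrite lerXn2r ?nnegrE ?expR_ge0//; first lra.
    by apply: le_trans (expR_ge1Dx _); lra.
  rewrite -expRM_natl (_ : 2%:R * (y / 8 - 1) = y / 4 - 2); last by field.
  by rewrite expr2 [y ^+ 2]expr2; lra.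
have tail : expR (- (u ^+ 2 / 2)) * expR a <= expR (2^-1 - y / 4).
  by rewrite -expRD ler_expR /y in ay *; lra.
rewrite mulrCA; apply: (@le_trans _ _
    (8 * m ^+ 2 * y ^+ 2 * expR (2^-1 - y / 4))).
  by apply: ler_pM => //; rewrite divr_ge0// sqr_ge0.
apply: (@le_trans _ _
    (8 * m ^+ 2 * (64 * expR (y / 4 - 2)) * expR (2^-1 - y / 4))).
  by rewrite ler_wpM2r ?expR_ge0// ler_wpM2l// mulr_ge0// sqr_ge0.
rewrite le_eqVlt; apply/orP; left; apply/eqP.
have -> : expR (- 2^-1) ^+ 3 = expR (y / 4 - 2) * expR (2^-1 - y / 4) :> R.
  by rewrite -expRM_natl -expRD; congr expR; field.
by ring.
Qed.

(* h is 1 / sqrt e and z is sqrt n times the excess of eps / sigma over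
   512 / sqrt n; q is sqrt n times the tilting parameter. *)
Lemma exponent_bound (R : realFieldType) (h z q : R) :
    0 <= h <= 5 / 8 -> 0 <= z -> q = z * h ^+ 2 / 180 + 400^-1 ->
  1 + 512 * h ^+ 3 * q ^+ 2 - q * (z + 512) <= - (z ^+ 2 * h ^+ 2 / 256).
Proof.
move=> /andP[h0 h58] z0 ->.
have h3 : h ^+ 3 <= (5 / 8) ^+ 3 by rewrite lerXn2r ?nnegrE//; lra.
have h5 : h ^+ 5 <= (5 / 8) ^+ 5 by rewrite lerXn2r ?nnegrE//; lra.
have A0 : 0 <= z ^+ 2 * h ^+ 2 by rewrite mulr_ge0 ?sqr_ge0.
have B0 : 0 <= z * h ^+ 2 by rewrite mulr_ge0 ?sqr_ge0.
have hA := ler_wpM2r A0 h5; have hz := ler_wpM2r z0 h5.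
(* Coefficients are compared monomial by monomial: 1/180 exceeds 1/256 by enough to cover the square
   term in z^2, 1/400 covers the cross term in z, and 512/400 covers the constant 1 together with
   its square term. *)
have E w v : 512 * h ^+ 3 * (z * h ^+ 2 * w + v) ^+ 2 =
    512 * w ^+ 2 * (h ^+ 5 * (z ^+ 2 * h ^+ 2))
    + 2 * 512 * w * v * (h ^+ 5 * z) + 512 * v ^+ 2 * h ^+ 3 by ring.
have E' w v : (z * h ^+ 2 * w + v) * (z + 512) =
  z ^+ 2 * h ^+ 2 * w + z * v + 512 * w * (z * h ^+ 2) + 512 * v by ring.
rewrite E E'; lra.
Qed.

(** * Two-sided deviations, sub-Gaussian tails and the final bound *)

(** The factor 2 comes from exp |x| <= exp x + exp (-x). *)
Lemma iid_exp_abs_dev (R : realType) (d : measure_display)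
    (T : measurableType d) (P : probability T R) (n : nat)
    (Xs : 'I_n -> {RV P >-> R}) (F : R -> R) (a s r : R) :
    iid_samples Xs (fun s => (F s)%:E) ->
    0 <= F s <= 1 -> F s <= r \/ 1 - F s <= r ->
  (\int[P]_w (expR (a * `|\sum_(i < n) ((Xs i w <= s)%R%:R - F s)|))%:E
   <= (2 * expR (n%:R * (r * (a ^+ 2 / 2 * expR `|a|))))%:E)%E.
Proof.
move=> Xs_iid F01 Fr; pose S w := \sum_(i < n) ((Xs i w <= s)%R%:R - F s).
have mS : measurable_fun setT S.
  apply: measurable_sum => i; apply: measurable_funB => //.
  exact: (measurableT_comp
    (measurable_fun_le_nat _ _ _ _ (measurable_funPT (Xs i)))
    (pair2_measurable (s : measurableTypeR R))).
have mexpS b : measurable_fun setT (fun w => (expR (b * S w))%:E).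
  apply/measurable_EFinP; apply: measurableT_comp => //.
  by apply: measurable_funM.
apply: (@le_trans _ _
    (\int[P]_w ((expR (a * S w))%:E + (expR (- a * S w))%:E))%E).
  apply: ge0_le_integral => //.
  - apply/measurable_EFinP; apply: measurableT_comp => //.
    by apply: measurable_funM => //; apply: measurableT_comp.
  - exact: emeasurable_funD.
  - move=> w _; rewrite -EFinD lee_fin; have [S0|S0] := leP 0 (S w).
      by rewrite ger0_norm// lerDl expR_ge0.
    by rewrite ltr0_norm// mulNr mulrN lerDr expR_ge0.
rewrite ge0_integralD// mulr_natl mulr2n EFinD.
apply: leeD; first exact: iid_exp_dev.
have := iid_exp_dev _ _ _ _ _ _ _ Xs_iid (- a) s r F01 Fr.
by rewrite sqrrN normrN.
Qed.

Lemma sub_gaussian_cdf (R : realType) (d : measure_display)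
    (T : measurableType d) (P : probability T R) (X : {RV P >-> R})
    (sigma s : R) : 0 < sigma -> sub_gaussian X sigma ->
  let r := expR (- ((`|s| / sigma) ^+ 2 / 2)) in
  fine (cdf X s) <= r \/ 1 - fine (cdf X s) <= r.
Proof.
move=> sigma0 subG r.
have rE : expR (- (`|s| ^+ 2 / (2 * sigma ^+ 2))) = r.
  by congr (expR (- _)); field; exact: lt0r_neq0.
have fcdf : cdf X s \is a fin_num by rewrite fin_num_measure.
have cdfE : cdf X s = P [set w | (X w <= s)%R].
  by congr (P _); apply/seteqP; split => w /=; rewrite in_itv.
have mX : measurable [set w | (X w <= s)%R].
  exact/measurable_sublevel/measurable_funPT.
have [s0|s0|s0] := ltgtP s 0.
- have ns0 : 0 < `|s| by rewrite normr_gt0 lt_eqF.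
  have [_] := subG _ ns0; rewrite rE ltr0_norm// opprK => h.
  by left; rewrite -lee_fin fineK// cdfE.
- have ns0 : 0 < `|s| by rewrite normr_gt0 gt_eqF.
  have [+ _] := subG _ ns0; rewrite rE gtr0_norm// => h.
  right; rewrite -lee_fin EFinB fineK// cdfE -probability_setC//.
  apply: le_trans h; apply: le_measure; rewrite ?inE.
  + exact: measurableC.
  + rewrite (_ : mkset _ = X @^-1` `[s, +oo[).
      by rewrite -[Y in measurable Y]setTI; exact: measurable_funPT.
    by apply/seteqP; split => w /=; rewrite in_itv/= andbT.
  + by move=> w /= /negP; rewrite -ltNge => /ltW.
(* At s = 0 the tail hypothesis is silent, but there [r] is 1. *)
- left; rewrite /r s0 normr0 mul0r expr0n/= mul0r oppr0 expR0.
  rewrite -lee_fin -s0 fineK//.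
  exact: cdf_le1.
Qed.

Lemma cdf_fine_ge0_le1 (R : realType) (d : measure_display)
    (T : measurableType d) (P : probability T R) (X : {RV P >-> R}) s :
  0 <= fine (cdf X s) <= 1.
Proof.
by rewrite fine_ge0// -lee_fin fineK ?fin_num_measure//; exact: cdf_le1.
Qed.

Lemma empirical_ge0_le1 (R : realType) (n : nat) (x : 'I_n -> R) t :
  0 <= (n%:R^-1 * \sum_(i < n) (x i <= t)%R%:R : R) <= 1.
Proof.
rewrite mulr_ge0 ?invr_ge0//=; last by apply: sumr_ge0.
have [n0|n0] := posnP n.
  by have -> : n%:R^-1 = 0 :> R; rewrite ?mul0r// n0 invr0.
rewrite mulrC ler_pdivrMr ?ltr0n// mul1r.
have -> : n%:R = \sum_(i < n) 1 :> R by rewrite sumr_const card_ord.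
by apply: ler_sum => i _; rewrite lern1 leq_b1.
Qed.

Lemma wasserstein1_empirical (R : realType) (d : measure_display)
    (T : measurableType d) (P : probability T R) (X : {RV P >-> R})
    (n : nat) (x : 'I_n -> R) : (0 < n)%N ->
  wasserstein1 (empirical_cdf x) (cdf X) = (\int[lebesgue_measure]_s
    `|n%:R^-1 * \sum_(i < n) (x i <= s)%R%:R - fine (cdf X s)|%:E)%E.
Proof.
move=> n0; have [Q1 hQ1] := quantile_empirical _ _ x n0.
have [Q2 hQ2] := quantile_cdf _ _ _ _ X.
rewrite -(wasserstein1_quantile _ _ _ _ _ _ _ hQ1 hQ2).
- congr wasserstein1; apply/funext => s.
  by rewrite fineK// fin_num_measure.
- exact: empirical_ge0_le1.
- exact: cdf_fine_ge0_le1.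
Qed.

Theorem lemma8 (R : realType)
    (d0 : measure_display) (T0 : measurableType d0) (P0 : probability T0 R)
    (X : {RV P0 >-> R}) (sigma : R)
    (sigma_gt0 : 0 < sigma) (X_subG : sub_gaussian X sigma)
    (d : measure_display) (T : measurableType d) (P : probability T R)
    (n : nat) (n_ge1 : (1 <= n)%N)
    (Xs : 'I_n -> {RV P >-> R}) (Xs_iid : iid_samples Xs (cdf X))
    (eps : R)
    (eps_lb : 512 * sigma / Num.sqrt n%:R < eps)
    (eps_ub : eps < 512 * sigma / Num.sqrt n%:R
                    + 16 * sigma * Num.sqrt (expR 1)) :
  (P [set w | (eps%:E
         < wasserstein1 (empirical_cdf (fun i => Xs i w)) (cdf X))%E]
   <= (expR (- (n%:R / (256 * sigma ^+ 2 * expR 1)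
                * (eps - 512 * sigma / Num.sqrt n%:R) ^+ 2)))%:E)%E.
Proof.
pose F s := fine (cdf X s).
have F01 s : 0 <= F s <= 1 by exact: cdf_fine_ge0_le1.
have {}Xs_iid : iid_samples Xs (fun s => (F s)%:E).
  congr (iid_samples Xs _) : Xs_iid; apply/funext => s.
  by rewrite fineK// fin_num_measure.
pose N : R := Num.sqrt n%:R; pose h : R := expR (- 2^-1).
have n0 : 0 < n%:R :> R by rewrite ltr0n.
have N1 : 1 <= N by rewrite -sqrtr1 ler_wsqrtr// ler1n.
have N0 : 0 < N by exact: lt_le_trans N1.
have NN : N ^+ 2 = n%:R by rewrite sqr_sqrtr// ltW.
have h0 : 0 < h by exact: expR_gt0.
have sqrt_e : Num.sqrt (expR 1) = h^-1 :> R.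
  have -> : expR 1 = expR 2^-1 ^+ 2 :> R.
    by rewrite -expRM_natl divff.
  by rewrite sqrtr_sqr ger0_norm ?expR_ge0// /h -expRN opprK.
have eh : expR 1 = h ^- 2.
  by rewrite -exprVn -sqrt_e sqr_sqrtr// expR_ge0.
have h58 : h <= 5 / 8.
  have := expR_half_ge R; rewrite -[expR _]invrK -expRN -/h => hh.
  have := ler_wpM2r (ltW h0) hh; rewrite mulVf ?gt_eqF//; lra.
pose z : R := N * (eps / sigma - 512 / N).
have z0 : 0 < z.
  apply: mulr_gt0; first exact: N0.
  by rewrite subr_gt0 (ltr_pdivlMr _ _ sigma_gt0) mulrAC.
(* The upper bound on [eps] in normalized form; it serves to keep [m] below 1/16, the range of
   [gaussian_tail_mgf]. *)
have zub : z * h < 16 * N.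
  have : eps / sigma - 512 / N < 16 * h^-1.
    rewrite ltrBlDl ltr_pdivrMr// mulrDl -sqrt_e.
    by rewrite mulrAC [16 * _ * sigma]mulrAC.
  rewrite ltr_pdivlMr// => zh.
  by rewrite /z -mulrA [ltRHS]mulrC ltr_pM2l.
(* The slope 1/180 is small enough for [m <= 16^-1]: with [zub] and h <= 5/8 the first term of [m]
   is at most 1/18, leaving room for 1/400. *)
pose q : R := z * h ^+ 2 / 180 + 400^-1; pose m := q / N.
have q0 : 0 < q.
  by have := mulr_ge0 (ltW z0) (sqr_ge0 h); rewrite /q; lra.
have m01 : 0 <= m <= 16^-1.
  rewrite divr_ge0 ?(ltW N0) ?(ltW q0)//= ler_pdivrMr// /q.
  rewrite expr2 mulrA; have := ler_wpM2r (ltW h0) (ltW zub).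
  have := ler_wpM2l (ltW N0) h58; lra.
pose lam := n%:R * m / sigma.
pose v (s : measurableTypeR R) : R := sigma / (2 * (sigma + `|s : R|) ^+ 2).
pose k (s : measurableTypeR R) : R := 2 * (sigma + `|s : R|) ^+ 2 / sigma.
pose g (x : T * measurableTypeR R) : R :=
  `|n%:R^-1 * \sum_(i < n) (Xs i x.1 <= x.2)%R%:R - F x.2|.
rewrite [X in P X](_ : _ =
    [set w | eps%:E < \int[lebesgue_measure]_s (g (w, s))%:E]%E); last first.
  by apply/seteqP; split => w; rewrite /= wasserstein1_empirical.
pose M := 2 * expR (n%:R * (512 * h ^+ 3 * m ^+ 2)).
have sa (s : R) : 0 < sigma + `|s| by rewrite ltr_wpDr.
apply: (@le_trans _ _ (expR (- (lam * eps)) * M)%:E).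
  apply: (chernoff_integral _ _ _ _ _ v k).
  - apply: measurableT_comp => //; apply: measurable_funB.
      apply: measurable_funM => //; apply: measurable_sum => i.
      exact: (measurable_fun_le_nat _ _ _ _ (measurable_funPT (Xs i))).
        apply: (measurableT_comp _ measurable_snd).
    exact: (measurableT_comp _ (cdf_measurable X)).
  - by move=> x; exact: normr_ge0.
  - exact: (continuous_measurable_fun (continuous_weight _ _ sigma_gt0)).
  - apply: measurable_funM => //; apply: measurable_funM => //.
    apply: measurable_funX; exact: measurable_funD.
  - by move=> s; rewrite divr_gt0// mulr_gt0// exprn_gt0.
  - move=> s; rewrite /v /k; field; apply/andP; split; exact: lt0r_neq0.
  - exact: integral_weight.
  - apply/ltW/(lt_trans _ eps_lb)/divr_gt0; last exact: N0.
    by rewrite pmulr_lgt0 ?ltr0n.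
  - by rewrite divr_gt0// mulr_gt0// divr_gt0.
  (* This is [lam * k s / n], the tilt seen by the unnormalized sum of deviations at s. *)
  - move=> s; pose a := 2 * m * (1 + `|s : R| / sigma) ^+ 2.
    rewrite (eq_integral (fun w => (expR (a *
        `|\sum_(i < n) ((Xs i w <= s)%R%:R - F s)|))%:E)) => [|w _]; last first.
      congr ((expR _)%:E).
      rewrite /g /= (_ : n%:R^-1 * _ - F s =
          n%:R^-1 * \sum_(i < n) ((Xs i w <= s)%R%:R - F s)).
        rewrite normrM gtr0_norm ?invr_gt0// /lam /a /k.
        by field; rewrite !lt0r_neq0.
      rewrite sumrB sumr_const card_ord mulrBr -[F s *+ n]mulr_natl mulrA.
      by rewrite mulVf ?lt0r_neq0// mul1r.
    apply: le_trans (iid_exp_abs_dev _ _ _ _ _ _ _ _ _ _ Xs_iid (F01 s)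
      (sub_gaussian_cdf _ _ _ _ _ _ _ sigma_gt0 X_subG)) _.
    have a0 : 0 <= a.
      by case/andP: m01 => *; rewrite mulr_ge0 ?sqr_ge0// mulr_ge0.
    rewrite lee_fin ler_wpM2l// ler_expR ler_wpM2l// (ger0_norm a0).
    by apply: (gaussian_tail_mgf R m (`|s| / sigma) a m01 _ erefl);
      rewrite divr_ge0// ltW.
(* The factor 2 of [M] becomes the summand 1 in [exponent_bound]. *)
have e2 : 2 <= expR 1 :> R by apply: le_trans (expR_ge1Dx 1); lra.
rewrite lee_fin; apply: (@le_trans _ _ (expR (- (lam * eps)) *
    (expR 1 * expR (n%:R * (512 * h ^+ 3 * m ^+ 2))))).
  by rewrite ler_wpM2l ?expR_ge0// ler_wpM2r ?expR_ge0.
rewrite -!expRD ler_expR.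
have h58' : 0 <= h <= 5 / 8 by rewrite h58 ltW.
have := exponent_bound _ h z q h58' (ltW z0) erefl.
have -> : n%:R * (512 * h ^+ 3 * m ^+ 2) = 512 * h ^+ 3 * q ^+ 2.
  by rewrite /m -NN; field; exact: lt0r_neq0.
have -> : lam * eps = q * (z + 512).
  by rewrite /lam /m /z -NN; field; rewrite !lt0r_neq0.
have -> : n%:R / (256 * sigma ^+ 2 * expR 1) * (eps - 512 * sigma / N) ^+ 2
    = z ^+ 2 * h ^+ 2 / 256.
  by rewrite eh /z -NN; field; rewrite !lt0r_neq0.
lra.
Qed.
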